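(* (i) Every three-distance set $X\subset\mathbb{R}^3$ with $|X|=14$ contains a five-point subset that is a two-distance set. (ii) Every three-distance set $X$ with $|X|=12$ lying on a sphere $\mathbb{S}^2$ in $\mathbb{R}^3$ contains either a five-point subset that is a two-distance set (lying on $\mathbb{S}^2$), or a four-point subset that is a two-distance set and lies on a circle $\mathbb{S}^1$.
   Context: For $X\subset\mathbb{R}^d$, let $A(X)=\{PQ \mid P,Q\in X,\ P\neq Q\}$, where $PQ$ denotes the Euclidean distance between $P$ and $Q$. The set $X$ is called a $k$-distance set if $|A(X)|=k$ (exactly $k$ distinct distances occur). Here $\mathbb{S}^2$ denotes a sphere in $\mathbb{R}^3$ (of some positive radius), and $\mathbb{S}^1$ denotes a circle, i.e. a sphere of positive radius in some two-dimensional affine plane of $\mathbb{R}^3$. *)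

(* Defs.v *)
From HB Require Import structures.
From mathcomp Require Import all_boot all_order all_algebra.
From mathcomp Require Import boolp classical_sets functions cardinality reals.

Set Implicit Arguments.
Unset Strict Implicit.
Unset Printing Implicit Defensive.

Import Order.TTheory GRing.Theory Num.Theory.
Local Open Scope classical_set_scope.
Local Open Scope card_scope.
Local Open Scope ring_scope.

(* The library's norm on 'rV[R]_d is the sup norm, hence an explicit
   Euclidean distance. *)
Definition edist (R : realType) (d : nat) (P Q : 'rV[R]_d) : R :=
  Num.sqrt (\sum_(i < d) (P 0 i - Q 0 i) ^+ 2).

Definition distances (R : realType) (d : nat) (X : set 'rV[R]_d) : set R :=
  [set t | exists P Q, [/\ X P, X Q, P <> Q & t = edist P Q]].

Definition distance_set (R : realType) (d k : nat) (X : set 'rV[R]_d) : Prop :=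
  distances X #= `I_k.

Definition esphere (R : realType) (d : nat) (c : 'rV[R]_d) (r : R) :
    set 'rV[R]_d :=
  [set P | edist c P = r].

Definition is_sphere (R : realType) (d : nat) (S : set 'rV[R]_d) : Prop :=
  exists c r, 0 < r /\ S = esphere c r.

Definition is_plane (R : realType) (d : nat) (H : set 'rV[R]_d) : Prop :=
  exists (a : 'rV[R]_d) (W : {vspace 'rV[R]_d}),
    \dim W = 2%N /\ H = [set P | P - a \in W].

Definition is_circle (R : realType) (d : nat) (S : set 'rV[R]_d) : Prop :=
  exists H c r, [/\ is_plane H, H c, 0 < r & S = H `&` esphere c r].

(* Main.v *)
(* Let D be the largest of the three distances and G the graph of the pairs at
   distance D; five points independent in G span at most two distances, hence
   exactly two, since R^3 has no five equidistant points.  Suppose that G has a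
   triangle ABC.  For a vertex Q off ABC, the cone spanned by the edges of G from
   Q to neighbours off ABC meets the plane directions of ABC only in 0: that
   plane is the union of the cones at A, B, C and of their opposites, and cones
   at different vertices neither meet nor, unless they share an edge, are
   opposite.  So all neighbours of Q lie strictly on one side of the plane
   through Q parallel to ABC, and this side 2-colours the rest of G, one colour
   class of which has at least five elements.  If G is triangle-free, then
   R(3,5) = 14 settles (i).  In (ii), the neighbours of a vertex v are independent
   and lie on a circle, the intersection of two spheres centred at v and at the
   centre of the sphere; if every degree is at most 3, then an edge count shows
   that a triangle-free graph on 12 vertices has five independent vertices. *)
Require Import Defs.
From mathcomp Require Import all_boot all_order all_algebra.
From mathcomp Require Import zify ring lra.

Set Implicit Arguments.
Unset Strict Implicit.
Unset Printing Implicit Defensive.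

Import Order.TTheory GRing.Theory Num.Theory.

(** * Independent sets in triangle-free graphs *)

Section Graph.
Variables (T : finType) (e : rel T).

Definition stable (S : {set T}) := [forall x in S, forall y in S, ~~ e x y].

Definition nbhd (A : {set T}) (x : T) : {set T} := [set y in A | e x y]%SET.

Definition non_nbhd (A : {set T}) (x : T) : {set T} :=
  [set y in A | (y != x) && ~~ e x y]%SET.

Definition has_stable (k : nat) (A : {set T}) :=
  [exists S : {set T}, [&& S \subset A, stable S & k <= #|S|]].

(** Counts ordered pairs: for a symmetric irreflexive relation, [adjacencies A A] is twice the
    number of edges inside [A]. *)
Definition adjacencies (A B : {set T}) := \sum_(x in A) #|nbhd B x|.

Lemma stableP (S : {set T}) :
  reflect {in S &, forall x y, ~~ e x y} (stable S).
Proof.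
apply: (iffP idP) => [st x y xS yS|st].
  by move: st => /forall_inP/(_ x xS)/forall_inP/(_ y yS).
by apply/forall_inP => x xS; apply/forall_inP => y yS; exact: st.
Qed.

Lemma has_stableP (k : nat) (A : {set T}) :
  reflect (exists2 S : {set T}, S \subset A & stable S /\ #|S| = k)
          (has_stable k A).
Proof.
apply: (iffP existsP) => [[S /and3P[SA stS kS]]|[S SA [stS Sk]]]; last first.
  by exists S; rewrite SA stS Sk leqnn.
have /card_geqP[s [us sk sS]] := kS.
exists [set x in s]%SET; first by apply/subsetP => x; rewrite inE => /sS/(subsetP SA).
split; last by rewrite cardsE (card_uniqP us).
by apply/stableP => x y; rewrite !inE => /sS xS /sS yS; exact: (stableP _ stS).
Qed.

(** Both colour classes are independent, and among [2k - 1] vertices one of them has at least [k]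
    elements. *)
Lemma has_stable_bipartite (k : nat) (A : {set T}) (c : T -> bool) :
  {in A &, forall x y, e x y -> c x != c y} -> k.*2.-1 <= #|A| -> has_stable k A.
Proof.
move=> cP kA.
pose C b := [set x in A | c x == b]%SET.
have st b : stable (C b).
  apply/stableP => x y; rewrite !inE => /andP[xA /eqP xb] /andP[yA /eqP yb].
  by apply/negP => /(cP x y xA yA); rewrite xb yb eqxx.
have cardA : #|A| = #|C true| + #|C false|.
  rewrite -(cardsID [set x | c x]%SET A).
  by congr (_ + _); apply: eq_card => x; rewrite !inE; case: (c x); rewrite ?andbT ?andbF.
have [b kb] : exists b, k <= #|C b|.
  by case: (leqP k #|C true|) => [|lt]; [exists true|exists false; lia].
apply/existsP; exists (C b); rewrite st kb !andbT.
by apply/subsetP => x; rewrite inE => /andP[].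
Qed.

(** * Double counting of edges *)

Hypothesis (e_sym : symmetric e) (e_irr : irreflexive e).

Lemma adjacenciesC (A B : {set T}) : adjacencies A B = adjacencies B A.
Proof.
rewrite /adjacencies.
under eq_bigr => x _ do rewrite -sum1dep_card.
under [RHS]eq_bigr => x _ do rewrite -sum1dep_card.
rewrite (exchange_big_dep (mem B)) /=; last by move=> x y _ /andP[].
apply: eq_bigr => y yB; apply: eq_bigl => x.
by rewrite e_sym yB; case: (x \in A).
Qed.

Lemma adjacenciesUr (A B C : {set T}) : [disjoint B & C] ->
  adjacencies A (B :|: C) = adjacencies A B + adjacencies A C.
Proof.
move=> dBC; rewrite /adjacencies -big_split; apply: eq_bigr => x _ /=.
have -> : nbhd (B :|: C) x = nbhd B x :|: nbhd C x.
  by apply/finset.setP => y; rewrite !inE andb_orl.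
apply/eqP; rewrite (leq_card_setU (nbhd B x) (nbhd C x)).
apply: disjointW dBC; apply/subsetP => y; by rewrite inE => /andP[].
Qed.

Lemma adjacenciesUl (A B C : {set T}) : [disjoint A & B] ->
  adjacencies (A :|: B) C = adjacencies A C + adjacencies B C.
Proof. by move=> dAB; rewrite adjacenciesC adjacenciesUr// !(adjacenciesC C). Qed.

Lemma adjacencies1 (x : T) (A : {set T}) : adjacencies [set x]%SET A = #|nbhd A x|.
Proof. by rewrite /adjacencies big_set1. Qed.

Lemma adjacencies_stable (A : {set T}) : stable A -> adjacencies A A = 0.
Proof.
move=> /stableP st; apply: big1 => x xA; apply/eqP; rewrite cards_eq0.
apply/eqP/finset.setP => y; rewrite !inE; apply/negP => /andP[yA xy].
by have := st x y xA yA; rewrite xy.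
Qed.

Lemma stable1 (x : T) : stable [set x]%SET.
Proof. by apply/stableP => y z /set1P-> /set1P->; rewrite e_irr. Qed.

(** Deleting a vertex [x] removes each edge at [x] from the count twice, once per end, so the parity
    is preserved. *)
Lemma handshake (A : {set T}) : ~~ odd (adjacencies A A).
Proof.
have [n] := ubnP #|A|; elim: n A => // n IH A An.
have [->|[x xA]] := set_0Vmem A; first by rewrite /adjacencies big_set0.
have dx : [disjoint [set x]%SET & A :\ x] by rewrite disjoints1 !inE eqxx.
have eA : adjacencies A A =
    (adjacencies [set x]%SET (A :\ x)).*2 + adjacencies (A :\ x) (A :\ x).
  rewrite -{1 2}(setD1K xA) adjacenciesUl// !adjacenciesUr//.
  rewrite (adjacenciesC (A :\ x)%SET [set x]%SET) (adjacencies_stable (stable1 x)).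
  by rewrite add0n addnA addnn.
rewrite eA oddD odd_double; apply: IH.
by move: An; rewrite (cardsD1 x A) xA.
Qed.

Lemma nbhd_split (A : {set T}) (v : T) : v \in A ->
  [/\ A = v |: (nbhd A v :|: non_nbhd A v),
      [disjoint [set v]%SET & nbhd A v :|: non_nbhd A v] &
      [disjoint nbhd A v & non_nbhd A v]].
Proof.
move=> vA; split.
- apply/finset.setP => y; rewrite !inE; have [->|] := eqVneq y v; rewrite ?vA//=.
  by case: (y \in A); case: (e v y).
- by rewrite disjoints1 !inE e_irr eqxx !andbF.
- rewrite -setI_eq0; apply/eqP/finset.setP => y; rewrite !inE.
  by case: (e v y); rewrite ?andbF.
Qed.

Lemma card_nbhd_split (A : {set T}) (v : T) : v \in A ->
  #|A| = (#|nbhd A v| + #|non_nbhd A v|).+1.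
Proof.
move=> vA; have [Adef dv dN] := nbhd_split vA.
have cardU (B C : {set T}) : [disjoint B & C] -> #|B :|: C| = #|B| + #|C|.
  by move=> dBC; apply/eqP; rewrite (leq_card_setU B C).
by rewrite {1}Adef !cardU// cards1.
Qed.

(** Adding [v] to independent non-neighbours of [v] keeps them independent. *)
Lemma non_nbhd_stable (k : nat) (A : {set T}) (v : T) :
  v \in A -> ~~ has_stable k.+1 A -> ~~ has_stable k (non_nbhd A v).
Proof.
move=> vA; apply: contra => /existsP[S /and3P[SA /stableP stS kS]].
apply/existsP; exists (v |: S)%SET; apply/and3P; split.
- apply/subsetP => x /setU1P[->//|/(subsetP SA)]; by rewrite inE => /andP[].
- apply/stableP => x y /setU1P[->|xS] /setU1P[->|yS]; rewrite ?e_irr//.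
  + by have := subsetP SA _ yS; rewrite inE => /and3P[].
  + by have := subsetP SA _ xS; rewrite inE e_sym => /and3P[].
  + exact: stS.
- rewrite cardsU1 (contra (subsetP SA v))//.
  by rewrite inE eqxx andbF.
Qed.

(** * Ramsey bounds for triangle-free graphs *)

Hypothesis triangle_free : forall x y z, e x y -> e y z -> e x z -> False.

Lemma stable_nbhd (A : {set T}) (v : T) : stable (nbhd A v).
Proof.
apply/stableP => x y; rewrite !inE => /andP[_ vx] /andP[_ vy].
by apply/negP => xy; exact: (triangle_free vx xy).
Qed.

(** Neighbours of [v] are independent, so every edge of [A] that is not inside [non_nbhd A v] has
    exactly one end in [nbhd A v]. *)
Lemma adjacencies_nbhd_split (A : {set T}) (v : T) : v \in A ->
  adjacencies A A = (adjacencies (nbhd A v) A).*2 +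
    adjacencies (non_nbhd A v) (non_nbhd A v).
Proof.
move=> vA; have [Adef dv dN] := nbhd_split vA.
have e1 : adjacencies [set v]%SET (nbhd A v) = adjacencies [set v]%SET A.
  by rewrite !adjacencies1; apply: eq_card => y; rewrite !inE; case: (e v y); rewrite ?andbF ?andbT.
have e2 : adjacencies [set v]%SET (non_nbhd A v) = 0.
  rewrite adjacencies1; apply/eqP; rewrite cards_eq0; apply/eqP/finset.setP => y.
  by rewrite !inE; case: (e v y); rewrite ?andbF.
have e3 := adjacencies_stable (stable_nbhd A v).
have e4 : adjacencies (nbhd A v) A = adjacencies [set v]%SET A +
    adjacencies (nbhd A v) (non_nbhd A v).
  rewrite {2}Adef !adjacenciesUr// e3 (adjacenciesC _ [set v]%SET) e1; lia.
have e5 : adjacencies (non_nbhd A v) A = adjacencies (nbhd A v) (non_nbhd A v) +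
    adjacencies (non_nbhd A v) (non_nbhd A v).
  by rewrite {2}Adef !adjacenciesUr// (adjacenciesC _ [set v]%SET) e2
     (adjacenciesC _ (nbhd A v)).
rewrite {1}Adef !adjacenciesUl// e4 e5; lia.
Qed.

Lemma degree_lt (k : nat) (A : {set T}) (v : T) :
  ~~ has_stable k A -> #|nbhd A v| < k.
Proof.
rewrite ltnNge; apply: contra => kN; apply/existsP; exists (nbhd A v).
rewrite stable_nbhd kN !andbT; apply/subsetP => x; by rewrite inE => /andP[].
Qed.

(** The Ramsey recursion: a vertex has at most [k] neighbours, these being independent, and its
    non-neighbours contain no [k] independent vertices. *)
Lemma ramsey3_step (k r : nat) :
  (forall A, ~~ has_stable k A -> #|A| <= r) ->
  forall A, ~~ has_stable k.+1 A -> #|A| <= (k + r).+1.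
Proof.
move=> rP A kA; have [->|[v vA]] := set_0Vmem A; first by rewrite cards0.
rewrite (card_nbhd_split vA) ltnS leq_add//.
  by have := degree_lt v kA.
exact/rP/non_nbhd_stable.
Qed.

Lemma ramsey3_1 (A : {set T}) : ~~ has_stable 1 A -> #|A| <= 0.
Proof.
apply: contraR; rewrite -ltnNge => /card_gt0P[x xA]; apply/existsP.
by exists [set x]%SET; rewrite stable1 cards1 sub1set xA.
Qed.

Lemma ramsey3_2 (A : {set T}) : ~~ has_stable 2 A -> #|A| <= 2.
Proof. exact: ramsey3_step ramsey3_1 A. Qed.

Lemma ramsey3_3 (A : {set T}) : ~~ has_stable 3 A -> #|A| <= 5.
Proof. exact: ramsey3_step ramsey3_2 A. Qed.

(** The recursion gives 9; with exactly 9 vertices every degree would be 3, and the degree sum 27 is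
    odd. *)
Lemma ramsey3_4 (A : {set T}) : ~~ has_stable 4 A -> #|A| <= 8.
Proof.
move=> stA; have := ramsey3_step ramsey3_3 stA; rewrite leq_eqVlt => /orP[/eqP A9|//].
have deg3 v : v \in A -> #|nbhd A v| = 3.
  move=> vA; have := degree_lt v stA.
  by have := ramsey3_3 (non_nbhd_stable vA stA); have := card_nbhd_split vA; lia.
have := handshake A; rewrite /adjacencies (eq_bigr (fun=> 3))//.
by rewrite sum_nat_const A9.
Qed.

Lemma ramsey3_5 (A : {set T}) : ~~ has_stable 5 A -> #|A| <= 13.
Proof. exact: ramsey3_step ramsey3_4 A. Qed.

(** Without five independent vertices the graph is cubic, and degree counts among the non-neighbours
    [H] of a vertex lead to a contradiction. *)
Lemma subcubic_stable5 (A : {set T}) : #|A| = 12 ->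
  (forall v, #|nbhd A v| <= 3) -> has_stable 5 A.
Proof.
move=> A12 deg_le; apply: contraT => stA.
have degA v : v \in A -> #|nbhd A v| = 3.
  move=> vA; have := deg_le v; have := card_nbhd_split vA.
  by have := ramsey3_4 (non_nbhd_stable vA stA); lia.
have [v vA] : exists v, v \in A by apply/card_gt0P; rewrite A12.
pose H := non_nbhd A v.
have stH : ~~ has_stable 4 H := non_nbhd_stable vA stA.
have H8 : #|H| = 8 by have := card_nbhd_split vA; rewrite degA// A12 -/H; lia.
(* Of the [12 * 3 = 36] ordered adjacencies, [2 * 9] involve a neighbour of [v]. *)
have HH : adjacencies H H = 18.
  have := adjacencies_nbhd_split vA; rewrite -/H.
  rewrite /adjacencies (eq_bigr (fun=> 3))// sum_nat_const A12.
  rewrite [X in _ = X.*2 + _](eq_bigr (fun=> 3)); last first.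
    by move=> x; rewrite inE => /andP[xA _]; exact: degA.
  by rewrite sum_nat_const degA//; lia.
have degH x : x \in H -> 2 <= #|nbhd H x| <= 3.
  move=> xH; have := ramsey3_3 (non_nbhd_stable xH stH).
  have := degree_lt x stH; have := card_nbhd_split xH; lia.
(* The five non-neighbours of [x] in [H] form a pentagon, which leaves degree sum
   [(18 - 10) / 2 = 4] to the two neighbours of [x], each of degree at least 2. *)
have deg2 x : x \in H -> #|nbhd H x| = 2 -> {in nbhd H x, forall y, #|nbhd H y| = 2}.
  move=> xH x2 y yx; have yH : y \in H by move: yx; rewrite inE => /andP[].
  have stM := non_nbhd_stable xH stH.
  have M5 : #|non_nbhd H x| = 5 by have := card_nbhd_split xH; lia.
  have := adjacencies_nbhd_split xH; rewrite HH.
  rewrite [X in _ + X](_ : _ = 10); last first.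
    rewrite /adjacencies (eq_bigr (fun=> 2)) ?sum_nat_const ?M5// => z zM.
    have := degree_lt z stM; have := ramsey3_2 (non_nbhd_stable zM stM).
    by have := card_nbhd_split zM; lia.
  rewrite /adjacencies (big_setD1 y)//=.
  have : \sum_(z in nbhd H x :\ y) 2 <= \sum_(z in nbhd H x :\ y) #|nbhd H z|.
    apply: leq_sum => z /setD1P[_]; rewrite inE => /andP[zH _].
    by have /andP[] := degH _ zH.
  rewrite sum_nat_const; have := cardsD1 y (nbhd H x); rewrite yx x2.
  have := degH _ yH; lia.
(* If all degrees in [H] were 2, there would be 16 adjacencies instead of 18. *)
have [x xH x3] : exists2 x, x \in H & #|nbhd H x| != 2.
  apply/exists_inP; apply: contraT; rewrite negb_exists_in => /forall_inP H2.
  move: HH; rewrite /adjacencies (eq_bigr (fun=> 2)); first by rewrite sum_nat_const H8.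
  by move=> x /H2/negPn/eqP.
have {}x3 : #|nbhd H x| = 3 by have := degH _ xH; lia.
have := adjacencies_nbhd_split xH; rewrite HH.
(* By [deg2] the neighbours of [x] cannot have degree 2, so they have degree 3, and their edges use
   up all 18 adjacencies of [H]. *)
have : \sum_(z in nbhd H x) 3 <= adjacencies (nbhd H x) H.
  apply: leq_sum => y yx; have yH : y \in H by move: yx; rewrite inE => /andP[].
  have := degH _ yH; have [y2|] := eqVneq #|nbhd H y| 2; last by lia.
  suff /(deg2 _ yH y2) : x \in nbhd H y by rewrite x3.
  by rewrite inE xH e_sym; move: yx; rewrite inE => /andP[].
have stM := non_nbhd_stable xH stH.
have M4 : #|non_nbhd H x| = 4 by have := card_nbhd_split xH; lia.
(* Yet [z] has a neighbour among the four non-neighbours of [x], since at most two of the other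
   three are not adjacent to it. *)
have [z zM] : exists z, z \in non_nbhd H x by apply/card_gt0P; rewrite M4.
rewrite sum_nat_const x3 [X in _ + X](big_setD1 z)//=.
have := ramsey3_2 (non_nbhd_stable zM stM); have := card_nbhd_split zM. lia.
Qed.

End Graph.

(** * Cones of diameters *)

Local Open Scope ring_scope.

(** * Inner products and regular simplices *)

Section DotProduct.
Variables (R : realFieldType) (n : nat).
Implicit Types u v w : 'rV[R]_n.

Definition dot u v : R := \sum_(i < n) u 0 i * v 0 i.

Lemma dotC u v : dot u v = dot v u.
Proof. by apply: eq_bigr => i _; rewrite mulrC. Qed.

Lemma dotDl u v w : dot (u + v) w = dot u w + dot v w.
Proof. by rewrite /dot -big_split; apply: eq_bigr => i _; rewrite mxE mulrDl. Qed.

Lemma dotDr u v w : dot w (u + v) = dot w u + dot w v.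
Proof. by rewrite !(dotC w) dotDl. Qed.

Lemma dotZl a u v : dot (a *: u) v = a * dot u v.
Proof. by rewrite /dot mulr_sumr; apply: eq_bigr => i _; rewrite mxE mulrA. Qed.

Lemma dotZr a u v : dot u (a *: v) = a * dot u v.
Proof. by rewrite dotC dotZl dotC. Qed.

Lemma dotNl u v : dot (- u) v = - dot u v.
Proof. by rewrite -scaleN1r dotZl mulN1r. Qed.

Lemma dotNr u v : dot u (- v) = - dot u v.
Proof. by rewrite dotC dotNl dotC. Qed.

Definition dotE := (dotDl, dotDr, dotZl, dotZr, dotNl, dotNr).

Lemma dot_sqrD u v : dot (u + v) (u + v) = dot u u + 2 * dot u v + dot v v.
Proof. by rewrite !dotE (dotC v u); ring. Qed.

Lemma dot_sqrB u v : dot (u - v) (u - v) = dot u u - 2 * dot u v + dot v v.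
Proof. by rewrite dot_sqrD !dotE; ring. Qed.

Lemma dot_comb w x y u v :
  dot w (x *: u + y *: v) = x * dot w u + y * dot w v.
Proof. by rewrite !dotE. Qed.

Lemma dot0l u : dot 0 u = 0.
Proof. by rewrite -(scale0r 0) dotZl mul0r. Qed.

Lemma dot_suml (I : finType) (P : pred I) (F : I -> 'rV[R]_n) v :
  dot (\sum_(i | P i) F i) v = \sum_(i | P i) dot (F i) v.
Proof. by rewrite (big_morph (dot^~ v) (fun x y => dotDl x y v) (dot0l v)). Qed.

Lemma dot_ge0 u : 0 <= dot u u.
Proof. by apply: sumr_ge0 => i _; rewrite -expr2 sqr_ge0. Qed.

Lemma dot_eq0 u : (dot u u == 0) = (u == 0).
Proof.
apply/idP/eqP => [|->]; last by rewrite dot0l.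
rewrite psumr_eq0 => [/allP u0|i _]; last by rewrite -expr2 sqr_ge0.
apply/rowP => i; rewrite mxE; apply/eqP.
by have := u0 i (mem_index_enum _); rewrite -expr2 sqrf_eq0.
Qed.

Lemma dot_gt0 u : (0 < dot u u) = (u != 0).
Proof. by rewrite lt_def dot_ge0 andbT dot_eq0. Qed.

(** The squared Euclidean distance: without square roots, the cone argument works over any
    [realFieldType]. *)
Definition sqd u v := dot (u - v) (u - v).

Lemma sqdC u v : sqd u v = sqd v u.
Proof. by rewrite /sqd -opprB dotNl dotNr opprK. Qed.

(** The law of cosines at the vertex [u]. *)
Lemma sqd_cos u v w :
  sqd v w = sqd v u + sqd w u - 2 * dot (v - u) (w - u).
Proof.
by rewrite /sqd !dotE (dotC w v) (dotC u v) (dotC u w); ring.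
Qed.

(** The Gram matrix is [d / 2] times the sum of the identity and the all-ones matrix, hence
    invertible: pairing a linear relation with [p j] makes each coefficient the negative of the
    coefficient sum [s], so [s = - k s] and [s = 0]. *)
Lemma simplex_row_free (k : nat) (p : 'I_k -> 'rV[R]_n) (d : R) : 0 < d ->
  (forall i, dot (p i) (p i) = d) ->
  (forall i j, i != j -> dot (p i) (p j) = d / 2) ->
  row_free (\matrix_i p i).
Proof.
move=> d0 pii pij; apply: inj_row_free => u; rewrite mulmx_sum_row => u0.
pose s := \sum_i u 0 i.
have us j : u 0 j = - s.
  have : dot (\sum_i u 0 i *: p i) (p j) = d / 2 * (s + u 0 j).
    rewrite dot_suml (bigD1 j)//= dotZl pii.
    rewrite (eq_bigr (fun i => d / 2 * u 0 i)) => [|i ij]; last first.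
      by rewrite dotZl pij// mulrC.
    have -> : s = u 0 j + \sum_(i < k | i != j) u 0 i by rewrite /s (bigD1 j).
    by rewrite -mulr_sumr; field.
  under eq_bigr => i _ do rewrite -[p i](rowK p).
  rewrite u0 dot0l => /esym/eqP; rewrite mulf_eq0 => /orP[/eqP|/eqP]; lra.
have s0 : s = 0.
  have : s = - s *+ k by rewrite {1}/s (eq_bigr (fun=> - s))// sumr_const card_ord.
  rewrite mulNrn => /eqP; rewrite -subr_eq0 opprK -mulrS mulrn_eq0 /= => /eqP//.
by apply/rowP => j; rewrite us s0 oppr0 mxE.
Qed.

(** By the law of cosines, the edge vectors at one vertex of a regular simplex satisfy the
    hypotheses of [simplex_row_free]. *)
Lemma equidistant_row_free (k : nat) (x : 'I_k.+1 -> 'rV[R]_n) (d : R) : 0 < d ->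
  (forall i j, i != j -> sqd (x i) (x j) = d) ->
  row_free (\matrix_i (x (lift ord0 i) - x ord0)).
Proof.
move=> d0 xd; apply: (simplex_row_free d0) => [i|i j ij].
  by rewrite -/(sqd _ _) xd.
have := sqd_cos (x ord0) (x (lift ord0 i)) (x (lift ord0 j)).
by rewrite !xd// => h; lra.
Qed.

End DotProduct.

(** * Cones spanned by diameters, with [d] the squared diameter *)

Section DiameterGraph.
Variables (R : realFieldType) (n : nat) (T : eqType) (f : T -> 'rV[R]_n) (d : R).
Hypothesis f_inj : injective f.
Hypothesis diam : forall x y, sqd (f x) (f y) <= d.

(** Two generators, possibly equal, suffice: a triangle has two sides at each vertex, and the
    2-colouring compares two neighbours at a time. The condition [0 < a + b] excludes the trivial
    combination. *)
Definition in_cone (S : pred T) (q : T) (v : 'rV[R]_n) :=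
  exists p p' a b, [/\ S p /\ S p', sqd (f p) (f q) = d /\ sqd (f p') (f q) = d,
    0 <= a /\ 0 <= b, 0 < a + b & v = a *: (f p - f q) + b *: (f p' - f q)].

(** In the triangle [p q x] the side [pq] is a longest one, so the angle at [q] is acute. *)
Lemma diameter_dot_gt0 (p q x : T) :
  sqd (f p) (f q) = d -> x != q -> 0 < dot (f p - f q) (f x - f q).
Proof.
move=> pq xq; have := sqd_cos (f q) (f p) (f x); have := diam p x.
have : 0 < sqd (f x) (f q) by rewrite dot_gt0 subr_eq0 (inj_eq f_inj).
rewrite pq; lra.
Qed.

Lemma in_cone_dot_gt0 (S : pred T) (q x : T) (v : 'rV[R]_n) :
  in_cone S q v -> x != q -> 0 < dot v (f x - f q).
Proof.
move=> [p [p' [a [b [_ [pq p'q] [a0 b0] ab ->]]]]] xq.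
have h := diameter_dot_gt0 pq xq; have h' := diameter_dot_gt0 p'q xq.
rewrite dotDl !dotZl; move: a0; rewrite le_eqVlt => /orP[/eqP a0|a0].
  by rewrite -a0 mul0r add0r mulr_gt0//; move: ab; rewrite -a0 add0r.
by rewrite ltr_pwDl ?mulr_gt0// mulr_ge0// ltW.
Qed.

(** A common vector would have positive inner product with [f q' - f q] and with its opposite. *)
Lemma cones_disjoint (S S' : pred T) (q q' : T) (v : 'rV[R]_n) :
  q != q' -> in_cone S q v -> in_cone S' q' v -> False.
Proof.
move=> qq' cq cq'; have := in_cone_dot_gt0 cq' qq'.
rewrite eq_sym in qq'; have := in_cone_dot_gt0 cq qq'.
by rewrite -(opprB (f q)) dotNr; lra.
Qed.

(* The left-hand side of the last hypothesis is [2 |v + s w|^2] plus two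
   nonnegative terms, so it vanishes only when [v = - s w]. *)
Lemma antipodal_bound (v w : 'rV[R]_n) (s t : R) :
  0 < s -> s <= t -> dot v v <= s ^+ 2 * d -> dot w w <= d ->
  s * t * (dot w w + d) + 2 * (s + t) * dot w v + 2 * dot v v <= 0 ->
  dot w v = - s * d /\ dot w w = d.
Proof.
move=> s0 st vd wd le0.
have sq : dot (v + s *: w) (v + s *: w) =
    dot v v + 2 * s * dot w v + s ^+ 2 * dot w w.
  by rewrite !dotE (dotC v w); ring.
have k0 : 0 <= s * (dot w w + d) + 2 * dot w v.
  rewrite -(pmulr_rge0 _ s0); have := dot_ge0 (v + s *: w); rewrite sq; nra.
have := dot_ge0 (v + s *: w).
have e1 : 2 * dot (v + s *: w) (v + s *: w) + s ^+ 2 * (d - dot w w) +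
    (t - s) * (s * (dot w w + d) + 2 * dot w v) <= 0.
  by rewrite sq; move: le0; congr (_ <= _); ring.
have k1 : 0 <= (t - s) * (s * (dot w w + d) + 2 * dot w v).
  by rewrite mulr_ge0// subr_ge0.
have s2 : 0 < s ^+ 2 by rewrite exprn_gt0.
have k2 : 0 <= s ^+ 2 * (d - dot w w) by rewrite mulr_ge0 ?subr_ge0// ltW.
move=> k3.
have wwd : dot w w = d.
  apply/eqP; rewrite eq_sym -subr_eq0 -(mulrI_eq0 _ (mulfI (lt0r_neq0 s2))).
  by apply/eqP; lra.
have /eqP : dot (v + s *: w) (v + s *: w) = 0 by lra.
rewrite dot_eq0 addr_eq0 => /eqP ->.
by rewrite dotNr dotZr wwd mulNr.
Qed.

(** Opposite vectors force equality in [antipodal_bound], so [v] would run along the diameter from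
    [q] to [c]. Then [c] would be an end of an edge within [S], although [S] and [S'] are
    disjoint. *)
Lemma cones_not_opposite_le (S S' : pred T) (q c p p' a a' : T) (x y x' y' : R) :
  (forall z, S z -> S' z -> False) -> S q -> S' c ->
  S p -> S p' -> S' a -> S' a' ->
  sqd (f p) (f q) = d -> sqd (f p') (f q) = d ->
  sqd (f a) (f c) = d -> sqd (f a') (f c) = d ->
  0 <= x -> 0 <= y -> 0 <= x' -> 0 <= y' -> 0 < x + y -> x + y <= x' + y' ->
  x *: (f p - f q) + y *: (f p' - f q) =
    - (x' *: (f a - f c) + y' *: (f a' - f c)) -> False.
Proof.
move=> SS' Sq Sc Sp Sp' Sa Sa' pq p'q ac a'c x0 y0 x0' y0' xy0 le_s.
set v := x *: _ + _ => vE.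
pose w := f q - f c.
have dist z t : sqd (f z) (f q) = d -> sqd (f t) (f c) = d ->
    dot w w + 2 * dot w (f z - f q) - 2 * dot w (f t - f c)
      - 2 * dot (f z - f q) (f t - f c) + d <= 0.
  move=> zq tc; have := diam z t; rewrite /sqd.
  have -> : f z - f t = w + (f z - f q) - (f t - f c).
    by apply/rowP => i; rewrite !mxE; ring.
  rewrite dot_sqrB dot_sqrD (dotDl w); move: zq tc; rewrite /sqd => -> ->; lra.
(* Strictness comes from disjointness: [z] differs from [c]. *)
have near z : S z -> sqd (f z) (f q) = d -> 0 < d + dot w (f z - f q).
  move=> Sz zq; have : 0 < sqd (f z) (f c).
    rewrite dot_gt0 subr_eq0 (inj_eq f_inj); apply/eqP => zc.
    by apply: (SS' z) => //; rewrite zc.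
  have ww := diam q c; rewrite -/w in ww.
  have -> : sqd (f z) (f c) = d + 2 * dot w (f z - f q) + dot w w.
    rewrite -zq /sqd (_ : f z - f c = (f z - f q) + w); last first.
      by apply/rowP => i; rewrite !mxE; ring.
    by rewrite dot_sqrD (dotC w); ring.
  move: ww; rewrite /sqd -/w; lra.
have wv : dot w v = x * dot w (f p - f q) + y * dot w (f p' - f q).
  exact: dot_comb.
have wv' : dot w v = - (x' * dot w (f a - f c) + y' * dot w (f a' - f c)).
  by rewrite vE dotNr dot_comb.
have vv : dot v v = - (x * x' * dot (f p - f q) (f a - f c) +
    x * y' * dot (f p - f q) (f a' - f c) + y * x' * dot (f p' - f q) (f a - f c) +
    y * y' * dot (f p' - f q) (f a' - f c)).
  rewrite {2}vE dotNr dot_comb !(dotC v) !dot_comb.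
  by rewrite !(dotC (f a - f c)) !(dotC (f a' - f c)); ring.
have vd : dot v v <= (x + y) ^+ 2 * d.
  have := sqd_cos (f q) (f p) (f p'); have := dot_ge0 (f p - f p').
  rewrite -/(sqd _ _) pq p'q => h1 h2.
  have -> : dot v v = x ^+ 2 * d + y ^+ 2 * d + 2 * x * y * dot (f p - f q) (f p' - f q).
    rewrite {2}/v dot_comb !(dotC v) !dot_comb (dotC (f p' - f q) (f p - f q)).
    by move: pq p'q; rewrite /sqd => -> ->; ring.
  have := mulr_ge0 (mulr_ge0 x0 y0) h1; rewrite h2; nra.
(* The bounds [dist] for the four pairs of ends, weighted by the products of the coefficients, add
   up to the last hypothesis of [antipodal_bound]. *)
have [|wvE wwE] := @antipodal_bound v w (x + y) (x' + y') xy0 le_s vd (diam q c).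
  have := mulr_ge0_le0 (mulr_ge0 x0 x0') (dist p a pq ac).
  have := mulr_ge0_le0 (mulr_ge0 x0 y0') (dist p a' pq a'c).
  have := mulr_ge0_le0 (mulr_ge0 y0 x0') (dist p' a p'q ac).
  have := mulr_ge0_le0 (mulr_ge0 y0 y0') (dist p' a' p'q a'c).
  move=> h1 h2 h3 h4; have := lerD (lerD h1 h2) (lerD h3 h4); rewrite !addr0.
  congr (_ <= _); rewrite vv.
  rewrite (_ : 2 * (_ + _) * dot w v =
    2 * (x' + y') * dot w v + 2 * (x + y) * dot w v); last by ring.
  by rewrite {1}wv wv'; ring.
have np := near p Sp pq; have np' := near p' Sp' p'q.
(* The equality case makes this sum vanish; by [near] both weights are then 0. *)
have /eqP : x * (d + dot w (f p - f q)) + y * (d + dot w (f p' - f q)) = 0.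
  by move: wvE; rewrite wv => h; rewrite !mulrDr addrACA h; ring.
rewrite paddr_eq0 ?mulr_ge0 ?(ltW np) ?(ltW np')//.
rewrite !mulf_eq0 !(gt_eqF np) !(gt_eqF np') !orbF => /andP[/eqP x_0 /eqP y_0].
by move: xy0; rewrite x_0 y_0 addr0 ltxx.
Qed.

(** The situation is symmetric in the two cones, so the one with the smaller coefficient sum may
    come first. *)
Lemma cones_not_opposite (S S' : pred T) (q c : T) (v : 'rV[R]_n) :
  (forall z, S z -> S' z -> False) -> S q -> S' c ->
  in_cone S q v -> in_cone S' c (- v) -> False.
Proof.
move=> SS' Sq Sc [p [p' [x [y [[Sp Sp'] [pq p'q] [x0 y0] xy vE]]]]].
move=> [a [a' [x' [y' [[Sa Sa'] [ac a'c] [x0' y0'] xy' vE']]]]].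
have vv : x *: (f p - f q) + y *: (f p' - f q) =
    - (x' *: (f a - f c) + y' *: (f a' - f c)) by rewrite -vE -vE' opprK.
have [le|/ltW le] := leP (x + y) (x' + y').
  exact: (cones_not_opposite_le SS' Sq Sc Sp Sp' Sa Sa' pq p'q ac a'c
            x0 y0 x0' y0' xy le vv).
have S'S z : S' z -> S z -> False by move=> S'z Sz; exact: (SS' z).
apply: (cones_not_opposite_le S'S Sc Sq Sa Sa' Sp Sp' ac a'c pq p'q
          x0' y0' x0 y0 xy' le).
by rewrite vv opprK.
Qed.

(* The six directions of the sides of the triangle split its plane into six
   sectors, each of them plus or minus the cone at one of the vertices. *)
Lemma triangle_sector (S : pred T) (a b c : T) (v : 'rV[R]_n) (x y : R) :
  S a -> S b -> S c -> v != 0 ->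
  sqd (f a) (f b) = d -> sqd (f b) (f c) = d -> sqd (f a) (f c) = d ->
  v = x *: (f b - f a) + y *: (f c - f a) ->
  exists2 q, S q & in_cone S q v \/ in_cone S q (- v).
Proof.
move=> Sa Sb Sc v0 ab bc ac vE.
have ba := ab; have cb := bc; have ca := ac.
rewrite sqdC in ba; rewrite sqdC in cb; rewrite sqdC in ca.
have xy0 : x = 0 -> y = 0 -> False.
  by move=> x0 y0; move: v0; rewrite vE x0 y0 !scale0r addr0 eqxx.
have solve q p p' z t : S q -> S p -> S p' -> sqd (f p) (f q) = d ->
    sqd (f p') (f q) = d -> 0 <= z -> 0 <= t ->
    (v = z *: (f p - f q) + t *: (f p' - f q) \/
     - v = z *: (f p - f q) + t *: (f p' - f q)) ->
    exists2 q, S q & in_cone S q v \/ in_cone S q (- v).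
  move=> Sq Sp Sp' pq p'q z0 t0 zt.
  have zt0 : 0 < z + t.
    rewrite lt_def addr_ge0// andbT; apply: contraNneq v0 => /eqP.
    rewrite paddr_eq0// => /andP[/eqP z_0 /eqP t_0].
    by case: zt; rewrite z_0 t_0 !scale0r addr0 => /eqP; rewrite ?oppr_eq0.
  exists q => //; case: zt => zt; [left|right]; by exists p, p', z, t.
have [y0|/ltW y0] := leP 0 y; have [x0|/ltW x0] := leP 0 x.
- apply: (solve a b c x y) => //; by left.
- have [yx|/ltW yx] := leP 0 (x + y).
  + apply: (solve c a b (x + y) (- x)); rewrite ?oppr_ge0//; right.
    by rewrite vE; apply/rowP => i; rewrite !mxE; ring.
  + apply: (solve b c a y (- (x + y))); rewrite ?oppr_ge0//; left.
    by rewrite vE; apply/rowP => i; rewrite !mxE; ring.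
- have [yx|/ltW yx] := leP 0 (x + y).
  + apply: (solve b c a (- y) (x + y)); rewrite ?oppr_ge0//; right.
    by rewrite vE; apply/rowP => i; rewrite !mxE; ring.
  + apply: (solve c a b (- (x + y)) x); rewrite ?oppr_ge0//; left.
    by rewrite vE; apply/rowP => i; rewrite !mxE; ring.
- apply: (solve a b c (- x) (- y)); rewrite ?oppr_ge0//; right.
  by rewrite vE; apply/rowP => i; rewrite !mxE; ring.
Qed.

(** By [triangle_sector] a vector of the plane lies, up to sign, in the cone at a vertex of the
    triangle; one sign contradicts [cones_disjoint], the other [cones_not_opposite]. *)
Lemma cone_misses_triangle_plane (S S' : pred T) (q a b c : T) (v : 'rV[R]_n)
    (x y : R) :
  (forall z, S z -> S' z -> False) -> S q -> S' a -> S' b -> S' c ->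
  sqd (f a) (f b) = d -> sqd (f b) (f c) = d -> sqd (f a) (f c) = d ->
  in_cone S q v -> v != x *: (f b - f a) + y *: (f c - f a).
Proof.
move=> SS' Sq Sa Sb Sc ab bc ac cv; apply/eqP => vE.
have ne z : S' z -> z != q by apply: contraPneq => -> S'q; exact: (SS' q).
have v0 : v != 0.
  apply/eqP => v0; have := in_cone_dot_gt0 cv (ne a Sa).
  by rewrite v0 dot0l ltxx.
have [r Sr [cr|cr]] := triangle_sector Sa Sb Sc v0 ab bc ac vE.
  by apply: (cones_disjoint _ cr cv); exact: ne.
exact: (cones_not_opposite SS' Sq Sr cv cr).
Qed.

End DiameterGraph.

(** * Two-colouring the points off a triangle of diameters *)

(** The vectors orthogonal to a common normal of [u] and [v] form a space of dimension 2 containing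
    both, hence equal to their span. *)
Lemma plane_normal (R : realFieldType) (u v : 'rV[R]_3) (d : R) : 0 < d ->
  dot u u = d -> dot v v = d -> dot u v = d / 2 ->
  exists N : 'cV[R]_3, forall w, (w *m N) 0 0 = 0 ->
    exists x y, w = x *: u + y *: v.
Proof.
move=> d0 uu vv uv.
pose p (i : 'I_2) := if i == 0 then u else v.
have fr : row_free (\matrix_i p i).
  apply: (simplex_row_free d0) => [i|i j]; rewrite /p.
    by case: ifP.
  by case: (altP (i =P 0)) => [->|i0]; case: (altP (j =P 0)) => [->|j0]//;
     rewrite ?eqxx// ?uv// ?[dot v u]dotC ?uv//; case: i j i0 j0 => [[|[|]]//] ? [[|[|]]//].
pose M := \matrix_i p i.
have rM : \rank M = 2%N by exact/eqP.
have : kermx M^T != 0 by rewrite -mxrank_eq0 mxrank_ker mxrank_tr rM.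
move=> /rowV0Pn[N /sub_kermxP NM N0]; exists N^T => w wN.
have MN : (M <= kermx N^T)%MS.
  by apply/sub_kermxP; rewrite -[M]trmxK -trmx_mul NM trmx0.
have rN : \rank (kermx N^T) = 2%N by rewrite mxrank_ker mxrank_tr rank_rV N0.
have [_] := mxrank_leqif_sup MN; rewrite rM rN eqxx => /esym NM'.
have /submx_trans/(_ NM')/submxP[D ->] : (w <= kermx N^T)%MS.
  by apply/sub_kermxP/matrixP => i j; rewrite !ord1 wN mxE.
exists (D 0 0), (D 0 1); rewrite mulmx_sum_row !big_ord_recl big_ord0 addr0.
by rewrite !rowK /p /=; congr (_ + D 0 _ *: _); apply/val_inj.
Qed.

Lemma triangle_bipartite (R : realFieldType) (T : finType) (f : T -> 'rV[R]_3)
    (d : R) (a b c : T) :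
  injective f -> 0 < d -> (forall x y, sqd (f x) (f y) <= d) ->
  sqd (f a) (f b) = d -> sqd (f b) (f c) = d -> sqd (f a) (f c) = d ->
  exists col : T -> bool, {in ~: [set a; b; c] &, forall x y,
    sqd (f x) (f y) = d -> col x != col y}.
Proof.
move=> f_inj d0 diam ab bc ac.
have [|||N NP] := @plane_normal R (f b - f a) (f c - f a) d d0.
- by rewrite -/(sqd _ _) sqdC.
- by rewrite -/(sqd _ _) sqdC.
- by have := sqd_cos (f a) (f b) (f c); rewrite bc ![sqd _ (f a)]sqdC ab ac; lra.
(* Up to scaling, the signed height of [f y] above the plane through [f x] parallel to the
   triangle. *)
pose h x y := ((f y - f x) *m N) 0 0.
pose S : {set T} := ~: [set a; b; c].
(* A combination of height 0 would be a direction of the triangle's plane lying in the cone at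
   [q]. *)
have miss q p p' x y : q \in S -> p \in S -> p' \in S ->
    sqd (f p) (f q) = d -> sqd (f p') (f q) = d -> 0 <= x -> 0 <= y -> 0 < x + y ->
    x * h q p + y * h q p' != 0.
  move=> Sq Sp Sp' pq p'q x0 y0 xy; apply/eqP => h0.
  have [|z [t]] := NP (x *: (f p - f q) + y *: (f p' - f q)).
    by rewrite mulmxDl -!scalemxAl !mxE -[RHS]h0 /h !mxE.
  apply/eqP.
  have SS' i : i \in S -> i \in [set a; b; c]%SET -> False by rewrite inE => /negP.
  apply: (cone_misses_triangle_plane f_inj diam (S := mem S)
           (S' := mem [set a; b; c]%SET) _ _ SS' Sq _ _ _ ab bc ac).
  - by rewrite !inE eqxx.
  - by rewrite !inE eqxx ?orbT.
  - by rewrite !inE eqxx ?orbT.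
  - by exists p, p', x, y.
have hN x y : h x y = - h y x by rewrite /h -opprB mulNmx mxE.
(* The colour records whether [x] has a neighbour above it. *)
exists (fun x => [exists y in S, (sqd (f x) (f y) == d) && (0 < h x y)]).
have key x y : x \in S -> y \in S -> sqd (f x) (f y) = d -> 0 < h x y ->
   [exists z in S, (sqd (f x) (f z) == d) && (0 < h x z)] !=
   [exists z in S, (sqd (f y) (f z) == d) && (0 < h y z)].
  move=> xS yS xy hxy.
  have -> : [exists z in S, (sqd (f x) (f z) == d) && (0 < h x z)].
    by apply/exists_inP; exists y => //; rewrite xy eqxx.
  rewrite eq_sym eqb_id; apply/exists_inP => -[z zS /andP[/eqP yz hyz]].
  rewrite sqdC in yz.
  (* These weights cancel the heights of a lower neighbour [x] and an upper neighbour [z] of [y]. *)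
  have := miss y x z (h y z) (h x y) yS xS zS xy yz (ltW hyz) (ltW hxy) (addr_gt0 hyz hxy).
  by rewrite (hN y x) mulrN mulrC addNr eqxx.
move=> x y xS yS xy; have := xy; rewrite sqdC => yx.
have := miss x y y 1 0 xS yS yS yx yx ler01 (lexx 0).
rewrite addr0 mul1r mul0r addr0 => /(_ ltr01).
rewrite neq_lt => /orP[hxy|]; last exact: key.
by rewrite eq_sym; apply: key => //; rewrite hN oppr_gt0.
Qed.

(** * Three-distance sets *)

From mathcomp Require Import boolp classical_sets functions cardinality reals.

Local Open Scope classical_set_scope.
Local Open Scope card_scope.
Local Open Scope ring_scope.

(** * Euclidean distances, spheres and circles *)

Section Points.
Variable R : realType.

Lemma edistE n (P Q : 'rV[R]_n) : edist P Q = Num.sqrt (sqd P Q).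
Proof.
by congr Num.sqrt; apply: eq_bigr => i _; rewrite !mxE expr2.
Qed.

Lemma sqr_edist n (P Q : 'rV[R]_n) : edist P Q ^+ 2 = sqd P Q.
Proof. by rewrite edistE sqr_sqrtr ?dot_ge0. Qed.

Lemma edist_ge0 n (P Q : 'rV[R]_n) : 0 <= edist P Q.
Proof. by rewrite edistE sqrtr_ge0. Qed.

Lemma edist_eq n (P Q : 'rV[R]_n) (r : R) : 0 <= r ->
  (edist P Q == r) = (sqd P Q == r ^+ 2).
Proof. by move=> r0; rewrite -sqr_edist eqrXn2 ?edist_ge0. Qed.

Lemma edist_gt0 n (P Q : 'rV[R]_n) : (0 < edist P Q) = (P != Q).
Proof. by rewrite edistE sqrtr_gt0 dot_gt0 subr_eq0. Qed.

Lemma edistC n (P Q : 'rV[R]_n) : edist P Q = edist Q P.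
Proof. by rewrite !edistE sqdC. Qed.

(** The plane is the kernel of the linear form [dot _ w], which is nonzero at [w]. *)
Lemma orthogonal_plane (w : 'rV[R]_3) : w != 0 ->
  exists W : {vspace 'rV[R]_3}, \dim W = 2%N /\ forall u, (u \in W) = (dot u w == 0).
Proof.
move=> w0; pose g : 'Hom('rV[R]_3, 'rV[R]_1) := linfun (mulmxr w^T).
have gE u : g u 0 0 = dot u w.
  by rewrite lfunE /= mxE; apply: eq_bigr => i _; rewrite mxE.
exists (lker g); split => [|u]; last first.
  rewrite memv_ker -gE; apply/eqP/eqP => [->|g0]; first by rewrite mxE.
  by apply/rowP => i; rewrite ord1 g0 mxE.
have := limg_ker_dim g fullv; rewrite capfv dimvf (dim_matrix _ 1 3).
have : (\dim (g @: fullv) <= 1)%N.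
  by rewrite (leq_trans (dimvS (subvf _)))// dimvf (dim_matrix _ 1 1).
suff : (0 < \dim (g @: fullv))%N.
  case: (\dim (g @: fullv)) => [|[|//]]// _ _.
  by rewrite addn1 => -[].
rewrite lt0n dimv_eq0; apply: contraNneq w0 => g0.
have := memv_img g (memvf w); rewrite g0 memv0 => /eqP gw.
by rewrite -dot_eq0 -gE gw mxE.
Qed.

(** By the law of cosines all points of [Y] have the same inner product [m] with [v - c] relative to
    [c], so they share a plane orthogonal to it. *)
Lemma spheres_meet_in_circle (c v : 'rV[R]_3) (r s : R) (Y : set 'rV[R]_3) :
  0 < r -> edist c v = r ->
  (forall P, Y P -> edist c P = r /\ edist P v = s) ->
  (exists P Q, [/\ Y P, Y Q & P <> Q]) ->
  exists2 C, is_circle C & Y `<=` C.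
Proof.
move=> r0 cv YP [P1 [P2 [YP1 YP2 P12]]].
pose w := v - c.
have ww : dot w w = r ^+ 2 by rewrite -cv sqr_edist sqdC.
have r2 : 0 < r ^+ 2 by rewrite exprn_gt0.
have w0 : w != 0 by rewrite -dot_gt0 ww.
have [W [dimW WP]] := orthogonal_plane w0.
pose m := (2 * r ^+ 2 - s ^+ 2) / 2.
(* The common projection of the points of [Y] onto the line through [c] and [v]. *)
pose o := c + (m / r ^+ 2) *: w.
have Pw P : Y P -> dot (P - c) w = m.
  move=> /YP[cP Pv]; have := sqd_cos c P v.
  by rewrite -(sqr_edist P v) Pv sqdC -sqr_edist cP sqdC -sqr_edist cv /w /m; lra.
have PoE P : P - o = (P - c) - (m / r ^+ 2) *: w by rewrite /o opprD addrA.
pose rho := Num.sqrt (r ^+ 2 - m ^+ 2 / r ^+ 2).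
have oP P : Y P -> edist o P = rho.
  move=> PY; rewrite edistE sqdC /sqd PoE dot_sqrB dotZr dotZl dotZr Pw// ww.
  rewrite -/(sqd P c) sqdC -sqr_edist (YP P PY).1 /rho; congr Num.sqrt.
  by field; rewrite lt0r_neq0.
exists ([set P | P - o \in W] `&` esphere o rho).
  exists [set P | P - o \in W], o, rho; split => //.
  - by exists o, W.
  - by rewrite /= subrr mem0v.
  (* Radius 0 would collapse the two distinct points of [Y] to [o]. *)
  - rewrite lt_neqAle sqrtr_ge0 andbT; apply/eqP => rho0.
    have eo P : Y P -> P = o.
      move=> /oP; rewrite -rho0 => oP0; apply/esym/eqP; apply: contraTT (lexx (0 : R)).
      by rewrite -edist_gt0 oP0 ltxx.
    by apply: P12; rewrite (eo P1)// (eo P2).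
move=> P PY; split; last exact: oP.
rewrite /= WP PoE dotDl dotNl dotZl Pw// ww.
by rewrite mulfVK ?subrr// lt0r_neq0.
Qed.

Lemma card_image_fset (T : finType) (f : T -> 'rV[R]_3) (S : {set T}) :
  injective f -> [set f i | i in [set` S]] #= `I_#|S|.
Proof.
move=> f_inj; rewrite card_eq_sym.
pose g (i : 'I_#|S|) := f (enum_val i).
have -> : [set f i | i in [set` S]] = range g.
  apply/seteqP; split => [_ [i iS <-]|_ [i _ <-]].
    by exists (enum_rank_in iS i) => //; rewrite /g enum_rankK_in.
  by exists (enum_val i) => //; exact: enum_valP.
apply: card_eq_trans card_II _; rewrite card_eq_sym; apply: inj_card_eq.
by move=> i j _ _ /f_inj/enum_val_inj.
Qed.

(** Later arguments treat [a] and [b] alike, so only the maximum is singled out. *)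
Lemma card3_max (A : set R) : A #= `I_3 ->
  exists a b D, [/\ a < D, b < D, a <> b & A = [set a; b; D]].
Proof.
move=> /eq_cardSP[x Ax /eq_cardSP[y [Ay yx] /eq_cardSP[z [[Az zx] zy]]]].
rewrite II0 card_eq0 => /eqP A0.
have AE : A = [set x; y; z].
  apply/seteqP; split => [t At|t [[->|->]|->]//].
  apply: contrapT => nt; have : set0 t by rewrite -A0; split; [split|];
   [split|..] => // e; apply: nt; [left; left|left; right|right].
  by [].
have ex p q t : A = [set p; q; t] -> p < t -> q < t -> p <> q ->
    exists a b D, [/\ a < D, b < D, a <> b & A = [set a; b; D]].
  by move=> *; exists p, q, t.
have zy' : z <> y by []. have zx' : z <> x by []. have yx' : y <> x by [].
have perm1 : A = [set x; z; y] by rewrite AE -setUA [_ `|` [set z]]setUC setUA.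
have perm2 : A = [set y; z; x] by rewrite AE -setUA setUC.
have lt (p q : R) : p <> q -> (p < q) || (q < p) by move=> pq; rewrite -neq_lt; apply/eqP.
have /orP[xy|xy] := lt _ _ yx'.
  have /orP[xz|xz] := lt _ _ zx'; last first.
    by apply: (ex x y z) => //; [exact: lt_trans xz|exact/nesym].
  by apply: (ex y z x) => // e; exact: zy'.
have /orP[yz|yz] := lt _ _ zy'; last first.
  by apply: (ex x y z) => //; [exact: lt_trans yz|exact/nesym].
by apply: (ex x z y) => // e; exact: zx'.
Qed.

End Points.

(** * The graph of diameters of a three-distance set *)

Section ThreeDistanceSet.
Variables (R : realType) (T : finType) (f : T -> 'rV[R]_3) (a b D : R).
Hypotheses (f_inj : injective f) (aD : a < D) (bD : b < D) (ab : a <> b).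
Hypothesis distf : distances (range f) = [set a; b; D].

Definition equidistant (S : {set T}) :=
  exists t, {in S &, forall x y, x != y -> edist (f x) (f y) = t}.

Definition diam_edge (x y : T) := edist (f x) (f y) == D.

Lemma edist_cases (x y : T) : x != y ->
  [\/ edist (f x) (f y) = a, edist (f x) (f y) = b | edist (f x) (f y) = D].
Proof.
move=> /eqP xy; have : distances (range f) (edist (f x) (f y)).
  by exists (f x), (f y); split => // /f_inj.
by rewrite distf => -[[]|]; [constructor 1|constructor 2|constructor 3].
Qed.

Lemma diameter_gt0 : 0 < D.
Proof.
have : distances (range f) D by rewrite distf; right.
by move=> [P [Q [_ _ /eqP PQ ->]]]; rewrite edist_gt0.
Qed.

Lemma sqd_le_diameter (x y : T) : sqd (f x) (f y) <= D ^+ 2.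
Proof.
rewrite -sqr_edist ler_pXn2r ?nnegrE ?edist_ge0 ?(ltW diameter_gt0)//.
have [->|/edist_cases[]->//] := eqVneq x y; rewrite ?ltW//.
by rewrite edistE /sqd subrr dot0l sqrtr0 diameter_gt0.
Qed.

Lemma diam_edge_sym : symmetric diam_edge.
Proof. by move=> x y; rewrite /diam_edge edistC. Qed.

Lemma diam_edge_irr : irreflexive diam_edge.
Proof.
move=> x; rewrite /diam_edge edistE /sqd subrr dot0l sqrtr0.
by rewrite lt_eqF ?diameter_gt0.
Qed.

Lemma diam_edge_sqd (x y : T) : diam_edge x y = (sqd (f x) (f y) == D ^+ 2).
Proof. by rewrite /diam_edge edist_eq ?ltW ?diameter_gt0. Qed.

(** Independence leaves only the distances [a] and [b]; if one did not occur, [S] would be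
    equidistant with the other. *)
Lemma stable_two_distance_set (S : {set T}) :
  stable diam_edge S -> ~ equidistant S -> distance_set 2 (f @` [set` S]).
Proof.
move=> /stableP st neq.
have cases x y : x \in S -> y \in S -> x != y ->
    edist (f x) (f y) = a \/ edist (f x) (f y) = b.
  move=> xS yS /edist_cases[]; [by left|by right|].
  by move=> /eqP xy; have := st x y xS yS; rewrite /diam_edge xy.
have occurs s t : (forall x y, x \in S -> y \in S -> x != y ->
    edist (f x) (f y) = s \/ edist (f x) (f y) = t) ->
    distances (f @` [set` S]) s.
  move=> st_cases; apply: contrapT => ns; apply: neq; exists t => x y xS yS xy.
  have [xys|//] := st_cases x y xS yS xy.
  exfalso; apply: ns; exists (f x), (f y).
  by split; [exists x|exists y|move=> /f_inj/eqP; apply/negP|].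
rewrite /distance_set; have -> : distances (f @` [set` S]) = [set a; b].
  apply/seteqP; split => [_ [_ [_ [[x xS <-] [y yS <-] xy ->]]]|_ [->|->]].
  - by apply: cases => //; apply: contra_not_neq xy => ->.
  - exact: occurs cases.
  - by apply: (occurs b a) => x y xS yS xy; apply/or_comm/cases.
apply/eq_cardSP; exists a; first by left.
have -> : [set a; b] `\ a = [set b].
  apply/seteqP; split => [x [[->|->]]//|_ ->]; first by move=> /(_ erefl).
  by split; [right|exact/nesym].
exact: card_set1.
Qed.

(** With [k.+2] points there are at least two, so the common distance is positive and
    [equidistant_row_free] applies. *)
Lemma equidistant_simplex (S : {set T}) (k : nat) :
  #|S| = k.+2 -> equidistant S ->
  exists2 x : 'I_k.+2 -> T, forall i, x i \in S &
    row_free (\matrix_(i < k.+1) (f (x (lift ord0 i)) - f (x ord0))).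
Proof.
move=> Sk [t tP].
pose x (i : 'I_k.+2) : T := enum_val (cast_ord (esym Sk) i).
have xS i : x i \in S by exact: enum_valP.
have xij i j : i != j -> x i != x j.
  by apply: contra_neq => /enum_val_inj/cast_ord_inj.
exists x => //; apply: (equidistant_row_free (x := f \o x) (d := t ^+ 2)).
  rewrite exprn_gt0// -(tP (x ord0) (x (lift ord0 ord0)))// ?xij//.
  by rewrite edist_gt0 (inj_eq f_inj) xij.
by move=> i j ij; rewrite -sqr_edist /= (tP (x i) (x j))// xij.
Qed.

(** Four edge vectors of a regular simplex would be independent in dimension 3. *)
Lemma not_equidistant5 (S : {set T}) : #|S| = 5%N -> ~ equidistant S.
Proof.
move=> S5 /(equidistant_simplex S5)[x _] /eqP rM.
by have := rank_leq_col (\matrix_(i < 4) (f (x (lift ord0 i)) - f (x ord0))); rewrite rM.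
Qed.

(** All points of [S] have the same inner product with [v - c], which is thus orthogonal to three
    independent edge vectors and so vanishes. *)
Lemma not_equidistant4 (S : {set T}) (c v : 'rV[R]_3) (r s : R) :
  #|S| = 4%N -> c != v ->
  {in S, forall x, edist c (f x) = r /\ edist (f x) v = s} -> ~ equidistant S.
Proof.
move=> S4 cv SP /(equidistant_simplex S4)[x xS].
set M := \matrix_i _ => frM; move/eqP: cv; apply.
have Mcv : (v - c) *m M^T = 0.
  apply/rowP => i; rewrite !mxE.
  have dotE' y : y \in S -> dot (v - c) (f y - c) = (sqd v c + r ^+ 2 - s ^+ 2) / 2.
    move=> /SP[cy yv]; have := sqd_cos c v (f y).
    by rewrite (sqdC v (f y)) (sqdC (f y) c) -!sqr_edist cy yv => h; lra.
  transitivity (dot (v - c) (f (x (lift ord0 i)) - f (x ord0))).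
    by apply: eq_bigr => j _; rewrite !mxE.
  have -> : f (x (lift ord0 i)) - f (x ord0) =
      (f (x (lift ord0 i)) - c) - (f (x ord0) - c).
    by rewrite opprB addrA subrK.
  by rewrite dotDr dotNr !dotE'// subrr.
have MU : M^T \in unitmx by rewrite unitmx_tr -row_free_unit.
apply/esym/eqP; rewrite -subr_eq0; apply/eqP.
by rewrite -[v - c](mulmxK MU) Mcv mul0mx.
Qed.

(** At least [9 = 2 * 5 - 1] vertices lie off the triangle, and they are 2-coloured by
    [triangle_bipartite]. *)
Lemma triangle_stable5 (x y z : T) : (12 <= #|T|)%N ->
  diam_edge x y -> diam_edge y z -> diam_edge x z ->
  has_stable diam_edge 5 [set: T].
Proof.
move=> T12 xy yz xz.
move: (xy) (yz) (xz); rewrite !diam_edge_sqd => /eqP xy' /eqP yz' /eqP xz'.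
have D2 : 0 < D ^+ 2 by rewrite exprn_gt0 ?diameter_gt0.
have [col colP] := triangle_bipartite f_inj D2 sqd_le_diameter xy' yz' xz'.
have T3 : (5.*2.-1 <= #|~: [set x; y; z]%SET|)%N.
  have := cardsC [set x; y; z]%SET.
  have : (#|[set x; y; z]%SET| <= 3)%N.
    rewrite -finset.setUA !cardsU1 cards1; lia.
  move: T12; lia.
have /existsP[S /and3P[_ stS S5]] : has_stable diam_edge 5 (~: [set x; y; z])%SET.
  apply: (has_stable_bipartite (c := col)) T3 => p q pS qS.
  by rewrite diam_edge_sqd => /eqP; exact: colP.
by apply/existsP; exists S; rewrite finset.subsetT stS S5.
Qed.

Lemma stable5_or_triangle_free : (12 <= #|T|)%N ->
  has_stable diam_edge 5 [set: T] \/
  (forall x y z, diam_edge x y -> diam_edge y z -> diam_edge x z -> False).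
Proof.
move=> T12; have [|nst] := boolP (has_stable diam_edge 5 [set: T]); [by left|right].
by move=> x y z xy yz xz; move/negP: nst; apply; exact: triangle_stable5 xy yz xz.
Qed.

Lemma stable5_two_distance_set : has_stable diam_edge 5 [set: T] ->
  exists Y : set 'rV[R]_3,
    [/\ Y `<=` range f, Y #= `I_5 & distance_set 2 Y].
Proof.
move=> /has_stableP[S _ [stS S5]]; exists (f @` [set` S]); split.
- exact: image_subset.
- by rewrite -S5; exact: card_image_fset.
- exact: stable_two_distance_set stS (not_equidistant5 S5).
Qed.

Lemma stable5_card14 : #|T| = 14%N -> has_stable diam_edge 5 [set: T].
Proof.
move=> T14; have [|//|tf] := stable5_or_triangle_free; first by rewrite T14.
apply: contraT => /(ramsey3_5 diam_edge_sym diam_edge_irr tf).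
by rewrite cardsT T14.
Qed.

(** Four neighbours of [v] are independent and lie on the spheres about [c] and [f v];
    [not_equidistant4] rules out a single distance among them. *)
Lemma degree4_circle (c : 'rV[R]_3) (r : R) (v : T) :
  (forall x y z, diam_edge x y -> diam_edge y z -> diam_edge x z -> False) ->
  0 < r -> (forall x, edist c (f x) = r) ->
  (4 <= #|nbhd diam_edge [set: T] v|)%N ->
  exists Y C : set 'rV[R]_3,
    [/\ Y `<=` range f, Y #= `I_4, distance_set 2 Y, is_circle C & Y `<=` C].
Proof.
move=> tf r0 cr deg4.
have : has_stable diam_edge 4 (nbhd diam_edge [set: T] v).
  by apply/existsP; exists (nbhd diam_edge [set: T] v); rewrite subxx deg4 stable_nbhd.
move=> /has_stableP[S SN [stS S4]].
have SP : {in S, forall x, edist c (f x) = r /\ edist (f x) (f v) = D}.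
  move=> x /(fintype.subsetP SN); rewrite inE => /andP[_ /eqP vx].
  by rewrite edistC [edist _ (f v)]edistC -{1}(cr x) edistC.
have cv : c != f v by rewrite -edist_gt0 cr.
have neq : ~ equidistant S by exact: not_equidistant4 S4 cv SP.
have [||C circC YC] := @spheres_meet_in_circle _ c (f v) r D (f @` [set` S]) r0 (cr v).
- by move=> _ [x xS <-]; exact: SP.
- have /card_gt1P[x [y [xS yS /eqP xy]]] : (1 < #|S|)%N by rewrite S4.
  by exists (f x), (f y); split; [exists x|exists y|move=> /f_inj].
exists (f @` [set` S]), C; split => //.
- exact: image_subset.
- by rewrite -S4; exact: card_image_fset.
- exact: stable_two_distance_set.
Qed.

End ThreeDistanceSet.

(** Enumerating the points gives the finite vertex type on which the graph lemmas operate. *)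
Lemma card_I_range (R : realType) (n : nat) (X : set 'rV[R]_3) : X #= `I_n ->
  exists2 f : 'I_n -> 'rV[R]_3, injective f & X = range f.
Proof.
move=> /card_set_bijP[g [gX g_inj gsurj]].
have /choice[f fP] : forall i : 'I_n, exists P, X P /\ g P = i.
  by move=> i; have [P XP gP] := gsurj i (ltn_ord i); exists P.
exists f => [i j fij|]; first by apply: val_inj; rewrite /= -(fP i).2 -(fP j).2 fij.
apply/seteqP; split => [P XP|_ [i _ <-]]; last exact: (fP i).1.
exists (Ordinal (gX P XP)) => //.
by apply: g_inj; rewrite ?inE ?(fP _).2//; exact: (fP _).1.
Qed.

Theorem theorem1p3 (R : realType) :
  (forall X : set 'rV[R]_3,
     distance_set 3 X -> X #= `I_14 ->
     exists Y : set 'rV[R]_3,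
       [/\ Y `<=` X, Y #= `I_5 & distance_set 2 Y])
  /\
  (forall (S X : set 'rV[R]_3),
     is_sphere S -> X `<=` S -> distance_set 3 X -> X #= `I_12 ->
     (exists Y : set 'rV[R]_3,
        [/\ Y `<=` X, Y `<=` S, Y #= `I_5 & distance_set 2 Y])
     \/
     (exists Y C : set 'rV[R]_3,
        [/\ Y `<=` X, Y #= `I_4, distance_set 2 Y, is_circle C & Y `<=` C])).
Proof.
split=> [X X3 /card_I_range[f f_inj XE]|].
  move: X3; rewrite XE => /card3_max[a [b [D [aD bD ab dist]]]].
  apply: (stable5_two_distance_set f_inj ab dist).
  by apply: (stable5_card14 f_inj aD bD dist); rewrite card_ord.
move=> S X [c [r [r0 SE]]] XS X3 /card_I_range[f f_inj XE].
move: X3 XS; rewrite XE => /card3_max[a [b [D [aD bD ab dist]]]] XS.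
have cr i : edist c (f i) = r.
  by have : S (f i) by [apply: XS; exists i]; rewrite SE.
have st5 : has_stable (diam_edge f D) 5 [set: 'I_12] ->
    exists Y, [/\ Y `<=` range f, Y `<=` S, Y #= `I_5 & distance_set 2 Y].
  move=> /(stable5_two_distance_set f_inj ab dist)[Y [Yf Y5 Y2]].
  by exists Y; split => //; exact: subset_trans XS.
have [|/st5|tf] := stable5_or_triangle_free f_inj aD bD dist; [by rewrite card_ord|by left|].
(* A vertex of degree at least 4 yields the circle; otherwise the graph is subcubic and has five
   independent vertices. *)
have [[v deg4]|deg3] := pselect (exists v, 4 <= #|nbhd (diam_edge f D) [set: 'I_12] v|)%N.
  right; exact: (degree4_circle f_inj ab dist tf r0 cr deg4).
left; apply/st5/subcubic_stable5 => //.
- exact: diam_edge_sym.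
- exact: (diam_edge_irr dist).
- by rewrite cardsT card_ord.
- move=> v; rewrite leqNgt; apply/negP => deg4; apply: deg3; by exists v.
Qed.
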